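(* Let $F\subseteq bcn(S)$ be compact in the topology of pointwise convergence on $S$, with $F\subseteq B(\ell_\infty(S))=\{f:S\to\mathbb{R} \mid \|f\|_\infty\le 1\}$, and let $\delta>0$ and $\epsilon\in(0,1)$ be given. Then there exists a subtree $T$ of $S$ with the following property: for every chain $\beta=(s_i)_{i=1}^\infty\in\mathcal{C}(T)$, every $f\in F$, every $n\in\mathbb{N}$ and every $I\subseteq\{i\le n\mid f(s_i)>0\}$ with $\sum_{i\in I}f(s_i)>\delta$, there exists $g\in F$ such that (i) $\sum_{i\in I}g^+(s_i)>(1-\epsilon)\sum_{i\in I}f(s_i)$, where $g^+=\max(g,0)$; and (ii) $\sum_{i\in J}|g(s_i)|<\epsilon\sum_{i\in I}f(s_i)$, where $J=\{i\le n \mid i\notin I \text{ or } g(s_i)<0\}$.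
   Context: $S=\bigcup_{n=0}^\infty\{0,1\}^n$ is the dyadic tree of all finite sequences in $\{0,1\}$ (including the empty one), partially ordered by the initial segment relation $\le$. A subtree of $S$ is a subset $T\subseteq S$, with the induced order, which has a single minimal element and in which every element has exactly two immediate successors (i.e. for each $t\in T$ there are exactly two minimal elements of $\{t'\in T: t<t'\}$); thus $T$ is order isomorphic to $S$. A chain of a tree $T$ is an infinite linearly ordered subset of $T$; $\mathcal{C}(T)$ is the set of all chains of $T$. A chain is written $\beta=(s_i)_{i=1}^\infty$ with its elements enumerated increasingly, $s_1<s_2<\cdots$. $bcn(S)$ denotes the set of all bounded functions $f:S\to\mathbb{R}$ such that for every chain $\beta$ of $S$ the sequence $(f(s))_{s\in\beta}$ converges to zero; it is endowed with the topology of pointwise convergence (the relative product topology of $\mathbb{R}^S$). *)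

(* Defs.v *)
From mathcomp Require Import all_boot all_order all_algebra.
From mathcomp Require Import all_classical all_reals all_analysis.
Set Implicit Arguments.
Unset Strict Implicit.
Unset Printing Implicit Defensive.
Import Order.TTheory GRing.Theory Num.Theory.
Import numFieldNormedType.Exports.
Local Open Scope classical_set_scope.
Local Open Scope ring_scope.

(* Dyadic tree, ordered by the initial segment relation [prefix]. *)
Definition dyadic := seq bool.

Definition strict_prefix (s t : dyadic) : bool := prefix s t && (s != t).

Definition minimals (A : set dyadic) : set dyadic :=
  [set t | A t /\ forall u, A u -> prefix u t -> u = t].

Definition imm_succ (T : set dyadic) (t : dyadic) : set dyadic :=
  minimals [set u | T u /\ strict_prefix t u].

Definition subtree (T : set dyadic) : Prop :=
  (exists r, minimals T = [set r]) /\
  (forall t, T t -> exists a b, a != b /\ imm_succ T t = [set a; b]).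

Definition chain (T C : set dyadic) : Prop :=
  [/\ C `<=` T, infinite_set C &
      forall s t, C s -> C t -> prefix s t || prefix t s].

(* [s 0] is the first element of the chain, i.e. s_1 in 1-based notation. *)
Definition chain_enum (C : set dyadic) (s : nat -> dyadic) : Prop :=
  range s = C /\ forall i j : nat, (i < j)%N -> strict_prefix (s i) (s j).

Definition bcn (R : realType) : set (dyadic -> R) :=
  [set f | bounded_fun f /\
     forall C s, chain [set: dyadic] C -> chain_enum C s ->
       f (s i) @[i --> \oo] --> (0 : R)].

(* Extended-real valued, hence meaningful also for unbounded functions. *)
Definition sup_norm (R : realType) (f : dyadic -> R) : \bar R :=
  ereal_sup (range (fun s => `|f s|%:E)).

Definition unit_ball (R : realType) : set (dyadic -> R) :=
  [set f | (sup_norm f <= 1%:E)%E].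

(* Main.v *)
Require Import Defs.
From mathcomp Require Import all_boot all_order all_algebra.
From mathcomp Require Import all_classical all_reals all_analysis.
From mathcomp Require Import ring lra.
Set Implicit Arguments.
Unset Strict Implicit.
Unset Printing Implicit Defensive.
Import Order.TTheory GRing.Theory Num.Theory.
Import numFieldNormedType.Exports.
Local Open Scope classical_set_scope.
Local Open Scope ring_scope.

(** The subtree is obtained by fusion, so that every node [t] of it has the
    following property: whenever [f] in [F] and [K] is a finite chain above [t],
    some [g] in [F] almost agrees with [f] on the predecessors of [t], is almost
    zero at [t], and has almost as large a sum of [g^+] over [K] as [f].  Running
    through the nodes of a chain and replacing the current function in this way
    at every node where its value is unwanted produces the required [g].

    That such a node exists for a single bound [c] on the sum over [K] and a
    single compact piece [G] of [F] is the heart of the matter.  Otherwise the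
    Nash-Williams dichotomy gives a branch [t_0 < t_1 < ...] and decreasing
    subtrees [X_i] such that every chain of [X_(i+1)] has an initial segment
    [K_i] for which the sum exceeds [c] for some function of [G], but only for
    functions with [|f t_i| >= e].  On a chain of [X_(r+1)] the segments [K_0, ..., K_r]
    are nested, so a function that works for the shortest one works for all of
    them and has modulus at least [e] at [t_0, ..., t_r].  A cluster point of
    these functions stays away from [0] along the branch, against
    [G `<=` bcn]. *)

(** * Embeddings of the dyadic tree and fusion *)

Lemma strict_prefix_trans : transitive strict_prefix.
Proof.
move=> t s u /andP[st sNt] /andP[tu tNu]; apply/andP; split.
  exact: prefix_trans st tu.
apply/eqP => su; move/eqP: sNt; apply.
case/prefixP: st => p tE; case/prefixP: tu => q uE.
move: uE; rewrite -su tE -catA => /(congr1 size)/eqP.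
rewrite !size_cat -[X in X == _]addn0 eqn_add2l eq_sym addn_eq0 => /andP[/nilP -> _].
by rewrite cats0.
Qed.

Lemma strict_prefix_irr : irreflexive strict_prefix.
Proof. by move=> s; rewrite /strict_prefix eqxx andbF. Qed.

Lemma prefix_anti s t : prefix s t -> prefix t s -> s = t :> dyadic.
Proof.
move=> st ts; apply: contrapT => /eqP sNt.
have := strict_prefix_irr s; rewrite (@strict_prefix_trans t)//; apply/andP.
  by [].
by rewrite eq_sym.
Qed.

Lemma strict_prefixP s t :
  reflect (exists b u, t = s ++ b :: u) (strict_prefix s t).
Proof.
apply: (iffP andP) => [[/prefixP[[|b u] ->]]|[b [u ->]]].
- by rewrite cats0 eqxx.
- by exists b, u.
- rewrite prefix_prefix; split => //; apply/eqP => /(congr1 size)/eqP.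
  by rewrite size_cat -[X in X == _]addn0 eqn_add2l.
Qed.

Lemma prefix_or_diverge (s t : dyadic) :
  [\/ prefix s t, exists b u, s = t ++ b :: u |
      exists p b u v, s = p ++ b :: u /\ t = p ++ ~~ b :: v].
Proof.
elim: s t => [|c s IH] [|d t]; first by constructor 1.
- by constructor 1; rewrite prefix0s.
- by constructor 2; exists c, s.
- have [<-{d}|cd] := eqVneq c d.
    case: (IH t) => [st|[b [u ->]]|[p [b [u [v [-> ->]]]]]].
    + by constructor 1; rewrite prefix_cons eqxx.
    + by constructor 2; exists b, u.
    + by constructor 3; exists (c :: p), b, u, v.
  constructor 3; exists [::], c, s, t; split => //=.
  by case: c d cd => [] [].
Qed.

(** Subtrees are handled as images of the whole dyadic tree. The equivalence also keeps incomparable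
    nodes incomparable. *)
Definition embedding (phi : dyadic -> dyadic) : Prop :=
  forall s t, prefix (phi s) (phi t) = prefix s t.

Definition refines (psi phi : dyadic -> dyadic) : Prop :=
  embedding psi /\ range psi `<=` range phi.

Definition cone (phi : dyadic -> dyadic) (s : dyadic) : dyadic -> dyadic :=
  fun u => phi (s ++ u).

(** Serves to thin out a tree above its root while keeping the root. *)
Definition reroot (t : dyadic) (phi : dyadic -> dyadic) : dyadic -> dyadic :=
  fun s => if s is [::] then t else phi s.

Lemma embedding_inj phi : embedding phi -> injective phi.
Proof.
move=> Ephi s t st; apply: prefix_anti; rewrite -Ephi st; exact: prefix_refl.
Qed.

Lemma embedding_strict phi s t : embedding phi ->
  strict_prefix (phi s) (phi t) = strict_prefix s t.
Proof.
by move=> Ephi; rewrite /strict_prefix Ephi (inj_eq (embedding_inj Ephi)).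
Qed.

Lemma prefix_root phi s : embedding phi -> prefix (phi [::]) (phi s).
Proof. by move=> ->; rewrite prefix0s. Qed.

Lemma refines_refl phi : embedding phi -> refines phi phi.
Proof. by move=> Ephi; split. Qed.

Lemma refines_trans chi phi psi :
  refines phi chi -> refines chi psi -> refines phi psi.
Proof. by move=> [? h1] [_ h2]; split => //; apply: subset_trans h2. Qed.

Lemma prefix_cat2l (s u v : dyadic) : prefix (s ++ u) (s ++ v) = prefix u v.
Proof. by rewrite prefix_catr// eqxx. Qed.

Lemma refines_cone phi s : embedding phi -> refines (cone phi s) phi.
Proof.
move=> Ephi; split; first by move=> u v; rewrite Ephi prefix_cat2l.
by move=> _ [u _ <-]; exists (s ++ u).
Qed.

Lemma cone_root phi s : cone phi s [::] = phi s.
Proof. by rewrite /cone cats0. Qed.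

Lemma range_cone phi s t : embedding phi ->
  range phi t -> prefix (phi s) t -> range (cone phi s) t.
Proof. by move=> Ephi [u _ <-]; rewrite Ephi => /prefixP[v ->]; exists v. Qed.

Lemma refines_into_cone phi psi s : embedding phi -> refines psi phi ->
  prefix (phi s) (psi [::]) -> refines psi (cone phi s).
Proof.
move=> Ephi [Epsi sub] rt; split=> // t psit; apply: range_cone => //.
  exact: sub.
by case: psit => u _ <-; apply: prefix_trans rt (prefix_root _ _).
Qed.

Lemma reroot_embedding t phi : embedding phi -> prefix t (phi [::]) ->
  embedding (reroot t phi).
Proof.
move=> Ephi tphi [|b s] [|c u] /=; rewrite ?prefix_refl ?prefix0s ?Ephi//.
  exact: (prefix_trans tphi (prefix_root _ Ephi)).
apply/negP => h; have := prefix_trans h tphi.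
by rewrite Ephi.
Qed.

Lemma reroot_refines phi psi : embedding phi -> refines psi phi ->
  refines (reroot (phi [::]) psi) phi.
Proof.
move=> Ephi [Epsi sub]; split.
  apply: reroot_embedding => //; have [|s _ <-] := sub (psi [::]) _.
    by exists [::].
  exact: prefix_root.
move=> _ [[|b s] _ <-] /=; first by exists [::].
by apply: sub; exists (b :: s).
Qed.

Lemma range_reroot t phi u : range (reroot t phi) u -> strict_prefix t u ->
  range phi u.
Proof.
move=> [[|b s] _ <-] /=; first by rewrite strict_prefix_irr.
by exists (b :: s).
Qed.

(** Two nodes are compared inside [Phi p], with [p] their longest common initial segment: there each
    is the root or starts with the bit at which they part. *)
Lemma embedding_of_cones phi (Phi : dyadic -> dyadic -> dyadic) :
    (forall s, embedding (Phi s)) -> (forall s, phi s = Phi s [::]) ->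
    (forall s b u, exists w, phi (s ++ b :: u) = Phi s (b :: w)) ->
  embedding phi.
Proof.
move=> EPhi root desc s t.
have [|[b [u ->]]|[p [b [u [v [-> ->]]]]]] := prefix_or_diverge s t.
- move=> /prefixP[[|b u] ->]; first by rewrite cats0 !prefix_refl.
  have [w ->] := desc s b u.
  by rewrite prefix_prefix root EPhi prefix0s.
- have [w ->] := desc t b u; rewrite root EPhi.
  by rewrite -[X in _ = prefix _ X]cats0 prefix_cat2l.
- have [w ->] := desc p b u; have [w' ->] := desc p (~~ b) v.
  by rewrite EPhi prefix_cat2l /=; case: b.
Qed.

(* Strict predecessors, latest first. *)
Definition predecessors (phi : dyadic -> dyadic) (s : dyadic) : seq dyadic :=
  rev [seq phi (take j s) | j <- iota 0 (size s)].

Lemma predecessors_rcons phi s b :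
  predecessors phi (rcons s b) = phi s :: predecessors phi s.
Proof.
rewrite /predecessors size_rcons -addn1 iotaD map_cat rev_cat /=.
rewrite add0n -cats1 take_size_cat//; congr cons.
congr rev; apply/eq_in_map => j; rewrite mem_iota /= add0n => js.
by rewrite takel_cat// ltnW.
Qed.

(** The root is kept because the properties in question refer to [phi [::]]. *)
Definition hereditary (P : (dyadic -> dyadic) -> Prop) : Prop :=
  forall phi psi, embedding phi -> refines psi phi ->
    psi [::] = phi [::] -> P phi -> P psi.

(** Density as in forcing. The witness may have a new root. *)
Definition dense_below (phi : dyadic -> dyadic)
    (P : (dyadic -> dyadic) -> Prop) : Prop :=
  forall psi, refines psi phi -> exists2 chi, refines chi psi & P chi.

(** At each node a tree with property [Q] is chosen for the predecessors already fixed; its root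
    becomes the node, and the construction goes on in the two cones above it. The final cone at a
    node refines the tree chosen there and has the same root, so heredity applies. *)
Lemma fusion (Q : seq dyadic -> (dyadic -> dyadic) -> Prop) phi :
    embedding phi ->
    (forall a, hereditary (Q a)) -> (forall a, dense_below phi (Q a)) ->
  exists2 psi, refines psi phi & forall s, Q (predecessors psi s) (cone psi s).
Proof.
move=> Ephi hQ dQ.
have dQ' x : exists chi, refines x.2 phi -> refines chi x.2 /\ Q x.1 chi.
  have [xphi|] := pselect (refines x.2 phi); last by exists phi.
  by have [chi ? ?] := dQ x.1 _ xphi; exists chi.
have /choice[ch chP] := dQ'.
(* A state consists of the nodes fixed so far on a branch, latest first, and the tree whose root is
   the next node. *)
pose step (x : seq dyadic * (dyadic -> dyadic)) (b : bool) :=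
  (x.2 [::] :: x.1, ch (x.2 [::] :: x.1, cone x.2 [:: b])).
pose X s := foldl step ([::], ch ([::], phi)) s.
pose psi s := (X s).2 [::].
have Xrcons s b : X (rcons s b) = step (X s) b by rewrite /X foldl_rcons.
have Xphi s : refines (X s).2 phi.
  elim/last_ind: s => [|s b IH].
    by have /= [] := chP ([::], phi) (refines_refl Ephi).
  have step_phi := refines_trans (refines_cone [:: b] IH.1) IH.
  rewrite Xrcons /=; set x := (_, _).
  by have [xx _] := chP x step_phi; exact: refines_trans step_phi.
have Xstep s b : refines (X (rcons s b)).2 (cone (X s).2 [:: b]).
  have step_phi := refines_trans (refines_cone [:: b] (Xphi s).1) (Xphi s).
  by rewrite Xrcons /=; set x := (_, _); have [] := chP x step_phi.
have Xcat s u : refines (X (s ++ u)).2 (X s).2.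
  elim/last_ind: u => [|u b IH]; first by rewrite cats0; exact: refines_refl (Xphi s).1.
  rewrite -rcons_cat; apply: refines_trans IH; apply: refines_trans (Xstep _ _) _.
  exact: refines_cone (Xphi _).1.
have desc s b u : exists w, psi (s ++ b :: u) = (X s).2 (b :: w).
  have [_ h] := refines_trans (Xcat (rcons s b) u) (Xstep s b).
  have [|w _ <-] := h (psi (s ++ b :: u)); last by exists w.
  by exists [::]; rewrite // cat_rcons.
have Epsi : embedding psi.
  by apply: (embedding_of_cones (Phi := fun s => (X s).2)) => // s; exact: (Xphi s).1.
have conepsi s : refines (cone psi s) (X s).2.
  split; first exact: (refines_cone _ Epsi).1.
  move=> _ [u _ <-]; rewrite /cone.
  by apply: (Xcat s u).2; exists [::].
exists psi => [|s].
  split => //; apply: subset_trans (Xphi [::]).2.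
  exact: (conepsi [::]).2.
have path_psi u : (X u).1 = predecessors psi u.
  elim/last_ind: u => [//|u b IH].
  by rewrite Xrcons predecessors_rcons /= IH.
apply: (hQ _ (X s).2 _ (Xphi s).1 (conepsi s)); first by rewrite cone_root.
rewrite -path_psi; elim/last_ind: {conepsi} s => [|s b _].
  by have /= [] := chP ([::], phi) (refines_refl Ephi).
have step_phi := refines_trans (refines_cone [:: b] (Xphi s).1) (Xphi s).
by rewrite Xrcons /=; set x := (_, _); have [_] := chP x step_phi.
Qed.

Lemma hereditary_all (I : eqType) (l : seq I)
    (P : I -> (dyadic -> dyadic) -> Prop) : (forall i, hereditary (P i)) ->
  hereditary (fun phi => forall i, i \in l -> P i phi).
Proof.
move=> hP phi psi Ephi psiphi rt Pphi i il.
exact: hP psiphi rt (Pphi i il).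
Qed.

(** Refining for one more index may move the root, and heredity does not survive that. So fusion
    first provides the properties of [l] at every cone; wherever the new root lands, the cone there
    has them. *)
Lemma dense_below_all (I : eqType) (l : seq I)
    (P : I -> (dyadic -> dyadic) -> Prop) phi :
    (forall i, hereditary (P i)) -> (forall i, dense_below phi (P i)) ->
  dense_below phi (fun psi => forall i, i \in l -> P i psi).
Proof.
move=> hP dP; elim: l => [|i l IH] psi psiphi.
  by exists psi => //; apply: refines_refl; exact: psiphi.1.
have Epsi := psiphi.1.
have [chi chipsi Pchi] : exists2 chi, refines chi psi &
    forall s j, j \in l -> P j (cone chi s).
  apply: (fusion (Q := fun=> fun x => forall j, j \in l -> P j x)) => //.
    by move=> _; exact: hereditary_all.
  by move=> _ x xpsi; apply: IH; exact: refines_trans psiphi.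
have [xi xichi Pxi] := dP i chi (refines_trans chipsi psiphi).
exists xi; first exact: refines_trans chipsi.
have [s _ rt] : range chi (xi [::]) by apply: xichi.2; exists [::].
move=> j; rewrite inE => /predU1P[-> //|jl].
apply: (hP _ (cone chi s)) (Pchi s j jl).
- exact: (refines_cone _ chipsi.1).1.
- apply: refines_into_cone => //; first exact: chipsi.1.
  by rewrite rt prefix_refl.
- by rewrite cone_root rt.
Qed.

Definition descending : rel dyadic := fun s t => strict_prefix t s.

Lemma descending_trans : transitive descending.
Proof. by move=> t s u ts ut; exact: strict_prefix_trans ut ts. Qed.

Lemma predecessorsP phi s t : reflect
  (exists2 u, strict_prefix u s & t = phi u) (t \in predecessors phi s).
Proof.
rewrite mem_rev; apply: (iffP mapP) => [[j]|[u /strict_prefixP[b [v ->]] ->]].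
  rewrite mem_iota /= add0n => js ->; exists (take j s) => //.
  apply/strict_prefixP; exists (nth false s j), (drop j.+1 s).
  by rewrite -drop_nth// cat_take_drop.
exists (size u); last by rewrite take_size_cat.
by rewrite mem_iota /= add0n size_cat /= addnS ltnS leq_addr.
Qed.

Lemma sorted_predecessors phi s : embedding phi ->
  sorted descending (predecessors phi s).
Proof.
move=> Ephi; elim/last_ind: s => [//|s b IH].
rewrite predecessors_rcons /= path_sortedE; last exact: descending_trans.
rewrite IH andbT; apply/allP => _ /predecessorsP[u us ->].
by rewrite /descending embedding_strict.
Qed.

(** Descending lists are determined by their entries. Hence the finite chains of the tree below a
    given node are among finitely many subsequences. *)
Lemma subseq_predecessors phi s a : embedding phi -> sorted descending a ->
    (forall t, t \in a -> range phi t /\ strict_prefix t (phi s)) ->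
  subseq a (predecessors phi s).
Proof.
move=> Ephi sa aphi.
suff -> : a = [seq t <- predecessors phi s | t \in a] by exact: filter_subseq.
apply: (irr_sorted_eq descending_trans _ sa).
- by move=> t; exact: strict_prefix_irr.
- by apply: sorted_filter (sorted_predecessors _ _) => //; exact: descending_trans.
- move=> t; rewrite mem_filter; case ta : (t \in a) => //=; apply/esym/predecessorsP.
  have [[u _ ut]] := aphi t ta; rewrite -ut embedding_strict// => us.
  by exists u.
Qed.

(** * Nash-Williams dichotomy for chains *)

Section nash_williams.
Variable B : seq dyadic -> Prop.

(* Finite chains are listed with the latest element first, so [catrev] below
   extends [a] by the first [n] elements of [x]. *)
Definition above (a : seq dyadic) (t : dyadic) : bool :=
  if a is u :: _ then strict_prefix u t else true.

(** Combinatorial forcing for [B]. Since [n = 0] is allowed, a list in [B] is accepted by every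
    tree, so a rejected list is not in [B]. *)
Definition accepts (phi : dyadic -> dyadic) (a : seq dyadic) : Prop :=
  forall x : nat -> dyadic, (forall i, range phi (x i)) ->
    (forall i, strict_prefix (x i) (x i.+1)) -> above a (x 0%N) ->
  exists n, B (catrev (mkseq x n) a).

Definition rejects (phi : dyadic -> dyadic) (a : seq dyadic) : Prop :=
  forall psi, refines psi phi -> ~ accepts psi a.

Lemma accepts_refines phi psi a : refines psi phi -> accepts phi a ->
  accepts psi a.
Proof.
move=> [_ sub] acc x xpsi xinc x0; apply: acc => // i.
by apply: sub.
Qed.

Lemma rejects_refines phi psi a : refines psi phi -> rejects phi a ->
  rejects psi a.
Proof. by move=> psiphi rej chi chipsi; apply: rej; exact: refines_trans psiphi. Qed.

Lemma chain_increasing (x : nat -> dyadic) :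
    (forall i, strict_prefix (x i) (x i.+1)) ->
  forall i j, (i < j)%N -> strict_prefix (x i) (x j).
Proof.
move=> xinc i; elim=> [//|j IH]; rewrite ltnS leq_eqVlt => /predU1P[-> //|ij].
exact: strict_prefix_trans (IH ij) (xinc j).
Qed.

Lemma accepts_cones phi a : embedding phi ->
  (forall s, accepts (cone phi s) (phi s :: a)) -> accepts phi a.
Proof.
move=> Ephi acc x xphi xinc _; have [s _ xs] := xphi 0%N.
have [i|i||n Bn] := acc s (fun i => x i.+1).
- apply: range_cone => //; rewrite xs.
  by case/andP: (chain_increasing xinc (ltn0Sn i)).
- exact: xinc.
- by rewrite /= xs.
exists n.+1; move: Bn; rewrite xs.
by rewrite /mkseq -[n.+1]add1n iotaD /= (iotaDl 1 0) -map_comp.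
Qed.

(** Otherwise acceptance of [a] extended by the root is dense; fusion makes it hold at every node,
    and then [a] itself is accepted, since every chain starts at some node. *)
Lemma rejects_extension phi a : embedding phi -> rejects phi a ->
  exists2 psi, refines psi phi & rejects psi (psi [::] :: a).
Proof.
move=> Ephi rej; apply: contrapT => none.
have [||psi psiphi acc] := fusion 
    (Q := fun _ chi => accepts chi (chi [::] :: a)) Ephi.
- by move=> _ chi psi Echi psichi ->; exact: accepts_refines.
- move=> _ psi psiphi; apply: contrapT => nacc; apply: none.
  exists psi => // chi chipsi acc; apply: nacc.
  (* Acceptance was obtained for the root of [psi], which must therefore be restored; chains above
     it never use it. *)
  exists (reroot (psi [::]) chi).
    by apply: reroot_refines => //; exact: psiphi.1.
  move=> /= x xchi xinc x0; apply: acc => // i.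
  apply: range_reroot (xchi i) _.
  case: i => [//|i]; apply: strict_prefix_trans x0 _.
  exact: chain_increasing.
- apply: (rej psi psiphi); apply: accepts_cones; first exact: psiphi.1.
  by move=> s; have := acc s; rewrite cone_root.
Qed.

(** If no refinement accepts the empty list, fusion decides at each node every chain below it.
    Rejection then passes from a chain to each one-step extension, so all finite chains are rejected
    and none is in [B]. *)
Lemma nash_williams phi : embedding phi ->
  (exists2 psi, refines psi phi & forall K, sorted descending K ->
     (forall t, t \in K -> range psi t) -> ~ B K) \/
  (exists2 psi, refines psi phi & accepts psi [::]).
Proof.
move=> Ephi.
have [?|nacc] := pselect (exists2 psi, refines psi phi & accepts psi [::]).
  by right.
left.
pose P a chi := rejects chi (chi [::] :: a) \/ accepts chi a.
have hP a : hereditary (P a).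
  move=> chi psi Echi psichi rt [rej|acc].
    by left; rewrite rt; exact: rejects_refines rej.
  by right; exact: accepts_refines acc.
have dP a : dense_below phi (P a).
  move=> chi chiphi.
  have [[psi psichi acc]|none] :=
      pselect (exists2 psi, refines psi chi & accepts psi a).
    by exists psi => //; right.
  have [|psi psichi rej] := @rejects_extension chi a chiphi.1.
    by move=> psi psichi acc; apply: none; exists psi.
  by exists psi => //; left.
(* A chain may skip nodes, so all subsequences of the predecessors have to be decided. *)
pose subseqs (a : seq dyadic) :=
  [seq mask (m : (size a).-tuple bool) a | m <- enum {: (size a).-tuple bool}].
have subseqsP a a0 : subseq a0 a -> a0 \in subseqs a.
  case/subseqP => m /eqP sm ->; apply/mapP; exists (Tuple sm) => //.
  by rewrite mem_enum.
have [||psi psiphi Ppsi] := fusion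
    (Q := fun a chi => forall a0, a0 \in subseqs a -> P a0 chi) Ephi.
- by move=> a; exact: hereditary_all.
- by move=> a; exact: dense_below_all.
have Epsi := psiphi.1.
(* For [t :: a], the decision made at the node [t] is used: acceptance of [a] there contradicts the
   induction hypothesis. *)
have rej a : sorted descending a -> forall s,
    (forall t, t \in a -> range psi t /\ strict_prefix t (psi s)) ->
    rejects (cone psi s) a.
  elim: a => [_ s _ chi chis acc|t a IH sta s tas].
    apply: nacc; exists chi => //.
    exact: refines_trans (refines_trans chis (refines_cone _ Epsi)) psiphi.
  have sa : sorted descending a by exact: path_sorted sta.
  have [[u _ ut] us] := tas t (mem_head _ _).
  move: us; rewrite -ut embedding_strict// => /[dup] us /andP[pus _].
  have au v : v \in a -> range psi v /\ strict_prefix v (psi u).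
    move=> va; split; first by apply: (tas v _).1; rewrite inE va orbT.
    have := sta; rewrite /= path_sortedE; last exact: descending_trans.
    by case/andP => /allP/(_ v va) + _; rewrite /descending -ut.
  have := Ppsi u a (subseqsP _ _ (subseq_predecessors Epsi sa au)).
  rewrite /P cone_root ut => -[ruta|acc].
    apply: rejects_refines ruta; apply: refines_into_cone => //.
      exact: refines_cone.
    by rewrite cone_root Epsi.
  exfalso; apply: (IH sa u au _ _ acc).
  exact: refines_refl (refines_cone _ Epsi).1.
exists psi => // K sK Kpsi BK.
case: K => [|t a] in sK Kpsi BK.
  apply: nacc; exists psi => // x _ _ _; by exists 0%N.
have [s _ st] := Kpsi t (mem_head _ _).
(* A successor of the last node of [K] lies strictly above all of [K]. *)
have := rej (t :: a) sK (s ++ [:: true]); apply.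
- move=> v vK; split; first exact: Kpsi.
  have : strict_prefix t (psi (s ++ [:: true])).
    by rewrite -st embedding_strict//; apply/strict_prefixP; exists true, [::].
  move: vK; rewrite inE => /predU1P[-> //|va tpsi].
  apply: strict_prefix_trans tpsi.
  have := sK; rewrite /= path_sortedE; last exact: descending_trans.
  by case/andP => /allP/(_ v va).
- exact: refines_refl (refines_cone _ Epsi).1.
- by move=> x _ _ _; exists 0%N.
Qed.

End nash_williams.

(** * Compactness *)

Lemma eval_continuous (R : realType) (t : dyadic) :
  continuous (fun h : {ptws dyadic -> R} => h t).
Proof. exact: (@proj_continuous dyadic (fun=> R)). Qed.

Lemma closed_eval (R : realType) (t : dyadic) (D : set R) : closed D ->
  closed [set h : {ptws dyadic -> R} | D (h t)].
Proof. by apply: preimage_closed => h _; exact: eval_continuous. Qed.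

(** Positive parts make the sum grow with the chain, which permits comparing nested initial
    segments. *)
Definition pos_sum (R : realType) (f : dyadic -> R) (K : seq dyadic) : R :=
  \sum_(t <- K) f^\+ t.

Lemma pos_sum_initial (R : realType) (f : dyadic -> R) x m n : (m <= n)%N ->
  pos_sum f (catrev (mkseq x m) [::]) <= pos_sum f (catrev (mkseq x n) [::]).
Proof.
move=> mn; rewrite /pos_sum !catrevE !cats0 !big_rev -(subnKC mn) /mkseq iotaD.
by rewrite map_cat big_cat /= lerDl sumr_ge0.
Qed.

Definition upper_chain (phi : dyadic -> dyadic) (K : seq dyadic) : Prop :=
  sorted descending K /\
  forall t, t \in K -> range phi t /\ strict_prefix (phi [::]) t.

Lemma upper_chain_refines phi psi K : refines psi phi ->
  psi [::] = phi [::] -> upper_chain psi K -> upper_chain phi K.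
Proof.
move=> [_ sub] rt [sK Kpsi]; split=> // t /Kpsi[psit]; rewrite rt => ?.
by split => //; exact: sub.
Qed.

Definition root_negligible (R : realType) (G : set (dyadic -> R)) (e c : R)
    (phi : dyadic -> dyadic) : Prop :=
  forall K, upper_chain phi K -> forall f, G f -> c < pos_sum f K ->
  exists g, [/\ G g, `|g (phi [::])| < e & c < pos_sum g K].

Lemma bcn_branch (R : realType) (g : dyadic -> R) (t : nat -> dyadic) :
    bcn g -> (forall i, strict_prefix (t i) (t i.+1)) ->
  g (t i) @[i --> \oo] --> (0 : R).
Proof.
move=> [_ gC] tinc; have tlt := chain_increasing tinc.
have tinj : injective t.
  move=> i j tij; have [ij|ji|//] := ltngtP i j.
    by have := tlt _ _ ij; rewrite tij strict_prefix_irr.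
  by have := tlt _ _ ji; rewrite tij strict_prefix_irr.
apply: (gC (range t)); last by split.
split=> //.
  have tE : (range t #= [set: nat])%card.
    by apply: inj_card_eq => ? ? _ _; exact: tinj.
  by rewrite (eq_finite_set tE); exact: infinite_nat.
move=> _ _ [i _ <-] [j _ <-]; have [ij|ji|->] := ltngtP i j.
- by have /andP[->] := tlt _ _ ij.
- by have /andP[-> _] := tlt _ _ ji; rewrite orbT.
- by rewrite prefix_refl.
Qed.

Lemma root_negligible_dense (R : realType) (G : set (dyadic -> R)) (e c : R) phi :
    @compact {ptws dyadic -> R} G -> G `<=` @bcn R -> 0 < e ->
  embedding phi -> exists2 psi, refines psi phi & root_negligible G e c psi.
Proof.
move=> cG Gbcn e0 Ephi; apply: contrapT => none.
pose bad t K := (exists2 f, G f & c < pos_sum f K) /\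
  forall f, G f -> c < pos_sum f K -> e <= `|f t|.
have step psi : exists chi, refines psi phi -> [/\ refines chi psi,
    strict_prefix (psi [::]) (chi [::]) & accepts (bad (psi [::])) chi [::]].
  have [psiphi|] := pselect (refines psi phi); last by exists psi.
  have [[chi chipsi good]|[chi chipsi acc]] :=
      nash_williams (bad (psi [::])) psiphi.1; last first.
    (* Passing to a cone puts the new root strictly above the old one. *)
    have coneX := refines_cone [:: true] chipsi.1.
    exists (cone chi [:: true]) => _; split.
    - exact: refines_trans chipsi.
    - rewrite cone_root; have /prefixP[u] : prefix (psi [::]) (chi [::]).
        have [s _ <-] : range psi (chi [::]) by apply: chipsi.2; exists [::].
        by apply: prefix_root; exact: psiphi.1.
      have : strict_prefix (chi [::]) (chi [:: true]).
        by rewrite (embedding_strict _ _ chipsi.1).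
      move=> /strict_prefixP[b [v ->]] ->; apply/strict_prefixP.
      by case: u => [|d u]; [exists b, v|exists d, (u ++ b :: v)]; rewrite ?cats0 -?catA.
    - exact: accepts_refines acc.
  (* With no bad chain in [chi], restoring the root of [psi] yields a [root_negligible] tree. *)
  exfalso; apply: none; exists (reroot (psi [::]) chi).
    by apply: refines_trans (psiphi); apply: reroot_refines => //; exact: psiphi.1.
  move=> K [sK Kchi] f Gf cf; apply: contrapT => ng; apply: (good K sK).
    by move=> t /Kchi[/range_reroot]; exact.
  split; first by exists f.
  move=> g Gg cg; rewrite leNgt; apply/negP => ge; apply: ng.
  by exists g.
have {step}[ch chP] := choice step.
pose X n := iter n ch phi; pose t n := X n [::].
have Xphi n : refines (X n) phi.
  elim: n => [|n IH]; first exact: refines_refl.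
  by have [h _ _] := chP _ IH; exact: refines_trans IH.
have Xle n m : (n <= m)%N -> refines (X m) (X n).
  elim: m => [|m IH]; first by rewrite leqn0 => /eqP ->; exact: refines_refl.
  rewrite leq_eqVlt => /predU1P[->|/IH]; first exact: refines_refl (Xphi _).1.
  by have [h _ _] := chP _ (Xphi m); exact: refines_trans.
have tinc i : strict_prefix (t i) (t i.+1) by have [] := chP _ (Xphi i).
have acc i m : (i < m)%N -> accepts (bad (t i)) (X m) [::].
  move=> im; have [_ _ h] := chP _ (Xphi i).
  exact: accepts_refines (Xle _ _ im) h.
have big r : exists f, G f /\ forall i, (i <= r)%N -> e <= `|f (t i)|.
  (* Any infinite chain of [X r.+1] would do. *)
  pose x i := X r.+1 (nseq i true).
  have xinc i : strict_prefix (x i) (x i.+1).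
    rewrite (embedding_strict _ _ (Xphi _).1); apply/strict_prefixP.
    exists true, [::]; have -> : i.+1 = (i + 1)%N by rewrite addn1.
    by rewrite nseqD.
  have /choice[n nP] : forall i : 'I_r.+1, exists n,
      bad (t i) (catrev (mkseq x n) [::]).
    by move=> i; apply: acc (ltn_ord i) _ _ xinc _ => // j; exists (nseq j true).
  case: (arg_minnP n (erefl : xpredT (ord0 : 'I_r.+1))) => i0 _ nmin.
  have [[f Gf cf] _] := nP i0.
  exists f; split=> // i ir; rewrite -ltnS in ir.
  apply: (nP (Ordinal ir)).2 => //; apply: lt_le_trans cf _.
  by apply: pos_sum_initial; exact: nmin.
have {big}[fr frP] := choice big.
pose H : set_system {ptws dyadic -> R} := fr @ \oo.
have [g [Gg Hg]] : G `&` cluster H !=set0.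
  by apply: cG; exists 0%N => // n _; case: (frP n).
(* The bound at [t i] is a closed condition satisfied by [fr n] for all [n >= i], so it passes to
   the cluster point. *)
have ge i : e <= `|g (t i)|.
  have cl : closed [set h : {ptws dyadic -> R} | e <= `|h (t i)|].
    apply: (closed_eval (D := [set y : R | e <= `|y|])).
    apply: (@preimage_closed _ _ (fun y : R => `|y|) [set y | e <= y]).
      by move=> y _; exact: norm_continuous.
    exact: closed_ge.
  move: Hg; rewrite clusterE => /(_ [set h | e <= `|h (t i)|]).
  rewrite -((closure_id _).1 cl); apply.
  by exists i => // n /= in_; case: (frP n) => _; apply.
have /cvgrPdist_lt/(_ e e0)[N _ /(_ N (leqnn N))] := bcn_branch (Gbcn _ Gg) tinc.
by rewrite /= sub0r normrN ltNge ge.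
Qed.

Definition mimicry (R : realType) (G : set (dyadic -> R)) (a : seq dyadic)
    (e c : R) (phi : dyadic -> dyadic) : Prop :=
  forall K, upper_chain phi K -> forall f, G f -> c < pos_sum f K ->
  exists g, [/\ G g, forall t, t \in a -> `|g t - f t| <= e,
    `|g (phi [::])| < e & c < pos_sum g K].

Lemma mimicry_hereditary (R : realType) (G : set (dyadic -> R)) a e c :
  hereditary (mimicry G a e c).
Proof.
move=> phi psi Ephi psiphi rt mim K Kpsi f Gf cf; rewrite rt.
by apply: mim => //; exact: upper_chain_refines Kpsi.
Qed.

(* Finitely many slabs [lo <= h t <= lo + e] cover [G]; staying in the slab of
   [f] keeps [g t] within [e] of [f t]. *)
Lemma mimicry_dense (R : realType) (G : set (dyadic -> R)) a e c phi :
    @compact {ptws dyadic -> R} G -> G `<=` @bcn R ->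
    (forall f, G f -> forall t, `|f t| <= 1) -> 0 < e ->
  dense_below phi (mimicry G a e c).
Proof.
move=> + + + e0; elim: a G => [|t a IH] G cG Gbcn Gball.
  move=> psi psiphi.
  have [chi chipsi neg] := root_negligible_dense c cG Gbcn e0 psiphi.1.
  exists chi => // K Kchi f Gf cf; have [g [Gg ge cg]] := neg K Kchi f Gf cf.
  by exists g; split.
pose slab (k : nat) : set (dyadic -> R) :=
  G `&` [set h | -1 + k%:R * e <= h t <= -1 + k.+1%:R * e].
(* Values at [t] lie in an interval of length 2, so [N] slabs of width [e] suffice. *)
pose N := (Num.truncn (2 / e)).+1.
have dense_slab k : dense_below phi (mimicry (slab k) a e c).
  apply: IH.
  - apply: compact_closedI => //.
    have -> : [set h : dyadic -> R | -1 + k%:R * e <= h t <= -1 + k.+1%:R * e] =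
        [set h : {ptws dyadic -> R} | h t \in `[-1 + k%:R * e, -1 + k.+1%:R * e]].
      by apply/seteqP; split=> h /=; rewrite in_itv.
    apply: (closed_eval (D := [set y : R | y \in _])).
    exact: itv_closed.
  - by move=> h [/Gbcn].
  - by move=> h [/Gball].
move=> psi psiphi.
have [chi chipsi mim] := @dense_below_all _ (iota 0 N) _ phi
  (fun k => @mimicry_hereditary R (slab k) a e c) dense_slab psi psiphi.
exists chi => // K Kchi f Gf cf.
have ft : 0 <= (f t + 1) / e.
  apply: divr_ge0; last exact: ltW.
  by have /ler_normlP[] := Gball f Gf t; lra.
pose k := Num.truncn ((f t + 1) / e).
have /andP[kle klt] := truncn_itv ft; rewrite -/k in kle klt.
rewrite ler_pdivlMr// in kle; rewrite ltr_pdivrMr// in klt.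
have kN : k \in iota 0 N.
  rewrite mem_iota /= add0n ltnS; apply: le_truncn.
  rewrite ler_pM2r ?invr_gt0// -lerBrDr.
  by have /ler_normlP[] := Gball f Gf t; lra.
have [|g [[Gg gt] ga gr cg]] := mim k kN K Kchi f _ cf.
  by split => //=; apply/andP; split; lra.
exists g; split => // u; rewrite inE => /predU1P[->|/ga//].
move: gt => /= /andP[g1 g2].
rewrite ler_norml; move: klt kle g1 g2; rewrite -natr1 => klt kle g1 g2.
by apply/andP; split; nra.
Qed.

(** Here one tree serves all bounds [c] up to [b], at the price of a loss [2 * e] in the sum. *)
Definition steers (R : realType) (F : set (dyadic -> R)) (a : seq dyadic)
    (e b : R) (phi : dyadic -> dyadic) : Prop :=
  forall K, upper_chain phi K -> forall f, F f ->
  exists g, [/\ F g, forall t, t \in a -> `|g t - f t| <= e,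
    `|g (phi [::])| <= e & Num.min (pos_sum f K) b - 2 * e <= pos_sum g K].

Lemma steers_hereditary (R : realType) (F : set (dyadic -> R)) a e b :
  hereditary (steers F a e b).
Proof.
move=> phi psi Ephi psiphi rt mim K Kpsi f Ff; rewrite rt.
by apply: mim => //; exact: upper_chain_refines Kpsi.
Qed.

Lemma steers_dense (R : realType) (F : set (dyadic -> R)) a e b phi :
    @compact {ptws dyadic -> R} F -> F `<=` @bcn R ->
    (forall f, F f -> forall t, `|f t| <= 1) -> 0 < e -> 0 <= b ->
  dense_below phi (steers F a e b).
Proof.
move=> cF Fbcn Fball e0 b0 psi psiphi.
(* If [m] lies between [k * e] and [(k + 1) * e], the shift by [e] makes [c k] strictly smaller than
   [m], yet larger than [m - 2 * e]. *)
pose c (k : nat) : R := k%:R * e - e.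
pose N := (Num.truncn (b / e)).+1.
have [chi chipsi mim] := @dense_below_all _ (iota 0 N) _ phi
  (fun k => @mimicry_hereditary R F a e (c k))
  (fun k => mimicry_dense a (c k) cF Fbcn Fball e0) psi psiphi.
exists chi => // K Kchi f Ff; set m := Num.min _ _.
have s0 : 0 <= pos_sum f K by apply: sumr_ge0.
have m0 : 0 <= m / e by apply: divr_ge0; [rewrite /m le_min s0|exact: ltW].
pose k := Num.truncn (m / e).
have /andP[kle klt] := truncn_itv m0; rewrite -/k in kle klt.
rewrite ler_pdivlMr// in kle; rewrite ltr_pdivrMr// -natr1 in klt.
have kN : k \in iota 0 N.
  rewrite mem_iota /= add0n ltnS; apply: le_truncn.
  by rewrite ler_pM2r ?invr_gt0// ge_min lexx orbT.
have mf : m <= pos_sum f K by rewrite ge_min lexx.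
have [|g [Fg ga gr cg]] := mim k kN K Kchi f Ff.
  by rewrite /c; lra.
exists g; split => //; first exact: ltW.
by rewrite /c in cg; lra.
Qed.

(** * Selection along a chain *)

(* The truncation at [(kappa i)^-1] leaves finitely many bounds to treat at each
   node.  It is harmless: if the total mass exceeds [(kappa i)^-1], then even a
   wasted value of [1] at [i] costs at most [kappa i] times the mass. *)
Section selection.
Variables (R : realType) (F : set (nat -> R)) (I : pred nat) (n : nat).
Variables (kappa : nat -> R) (delta : R).
Hypothesis kappa_gt0 : forall i, 0 < kappa i.
Hypothesis delta_gt0 : 0 < delta.
Hypothesis F_le1 : forall f, F f -> forall i, `|f i| <= 1.
Hypothesis F_steers : forall i, (i < n)%N -> forall f, F f ->
  exists g, [/\ F g,
    forall j, (j < i)%N -> `|g j - f j| <= delta * kappa i / i.+2%:R,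
    `|g i| <= delta * kappa i / i.+2%:R &
    Num.min (\sum_(i.+1 <= j < n | I j) f^\+ j) (kappa i)^-1
      - 2 * (delta * kappa i / i.+2%:R) <= \sum_(i.+1 <= j < n | I j) g^\+ j].

Let mass (f : nat -> R) := \sum_(0 <= j < n | I j) f^\+ j.

(* The part of [f j] that is counted as error when it comes to [j]. *)
Let waste (f : nat -> R) j := if I j then f^\- j else `|f j|.

Let massE f i : (i < n)%N -> mass f = \sum_(0 <= j < i | I j) f^\+ j +
  ((if I i then f^\+ i else 0) + \sum_(i.+1 <= j < n | I j) f^\+ j).
Proof.
move=> i_n; rewrite /mass (@big_cat_nat _ _ _ i) //=; last exact: ltnW.
congr (_ + _).
by rewrite big_ltn_cond//; case: ifP => _; rewrite ?add0r.
Qed.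

Let funrpos_lip (f g : nat -> R) j : f^\+ j - `|g j - f j| <= g^\+ j.
Proof.
rewrite /funrpos; have /ler_normlP[] := lexx `|g j - f j|.
by case: (leP (f j) 0); case: (leP (g j) 0); lra.
Qed.

Let waste_lip (f g : nat -> R) j : waste g j <= waste f j + `|g j - f j|.
Proof.
rewrite /waste; case: ifP => _.
  rewrite /funrneg; have /ler_normlP[] := lexx `|g j - f j|.
  by case: (leP (- f j) 0); case: (leP (- g j) 0); lra.
by rewrite addrC -{1}(subrK (f j) (g j)) ler_normD.
Qed.

(** The current function is kept at [i] if its value there is wanted, or if the mass is so large
    that the value is affordable. Otherwise it is replaced by a steered one. *)
Lemma selection_step f : F f -> delta < mass f -> forall i, (i <= n)%N ->
  exists g, [/\ F g,
    mass f - delta * \sum_(0 <= k < i) kappa k <= mass g &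
    \sum_(0 <= j < i) waste g j <= 2 * mass f * \sum_(0 <= k < i) kappa k].
Proof.
move=> Ff massf; elim=> [_|i IH i_n].
  by exists f; rewrite !big_geq// !mulr0 subr0.
have [g [Fg massg wasteg]] := IH (ltnW i_n).
have k0 := kappa_gt0 i.
have L0 : 0 <= \sum_(0 <= k < i) kappa k.
  by apply: sumr_ge0 => k _; exact: ltW.
have dk : delta * kappa i <= mass f * kappa i by rewrite ler_pM2r// ltW.
have dk0 : 0 < delta * kappa i by rewrite mulr_gt0.
set L := \sum_(0 <= k < i) kappa k in massg wasteg L0.
have [keep|act] := boolP ((I i && (0 < g i)) || ((kappa i)^-1 < mass f)).
  exists g; rewrite !big_nat_recr//= -/L; split => //; first by rewrite mulrDr; lra.
  rewrite mulrDr lerD// -mulrA.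
  case/orP: keep => [/andP[Ii gi]|big].
    have -> : waste g i = 0.
      by rewrite /waste Ii; apply/max_idPr; rewrite oppr_le0 ltW.
    by lra.
  have : 1 <= mass f * kappa i by rewrite -ler_pdivrMr// div1r ltW.
  have : waste g i <= 1; last by lra.
  rewrite /waste; have := F_le1 Fg i; case: ifP => // _ /ler_normlP[? ?].
  by rewrite /funrneg; case: (leP (- g i) 0); lra.
have [h [Fh hg hi hK]] := F_steers i_n Fg.
exists h; rewrite !big_nat_recr//= -/L.
set e := delta * kappa i / i.+2%:R in hg hi hK.
(* The denominator [i.+2] pays for a change of [e] at each of the [i] earlier indices and for the
   loss [2 * e] in the later sum. *)
have eE : i%:R * e + 2 * e = delta * kappa i.
  by rewrite /e -mulrDl -natrD addn2 mulrC divfK// pnatr_eq0.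
have e0 : 0 < e by rewrite /e divr_gt0.
have ie : 0 <= i%:R * e by rewrite mulr_ge0// ltW.
have sum_e : \sum_(0 <= j < i) e = i%:R * e.
  by rewrite sumr_const_nat subn0 mulr_natl.
move: act; rewrite negb_or negb_and -!leNgt => /andP[gi small].
split => //.
  rewrite (massE g i_n) in massg; rewrite (massE h i_n).
  have part : \sum_(0 <= j < i | I j) g^\+ j - i%:R * e <=
      \sum_(0 <= j < i | I j) h^\+ j.
    rewrite -sum_e lerBlDr [X in _ <= X + _]big_mkcond /= [X in X <= _]big_mkcond /=.
    rewrite -big_split /=; apply: ler_sum_nat => j /andP[_ ji].
    case: ifP => _; last by rewrite add0r ltW.
    by have := funrpos_lip g h j; have := hg j ji; lra.
  have hi0 : 0 <= if I i then h^\+ i else 0 by case: ifP.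
  have gi0 : (if I i then g^\+ i else 0) = 0.
    case: ifP gi => //= _ gi; rewrite /funrpos; apply/max_idPr; exact: gi.
  have hp : 0 <= \sum_(0 <= j < i | I j) h^\+ j by apply: sumr_ge0.
  (* If the minimum is [(kappa i)^-1], it is at least [mass f], and the later sum of [h] alone
     suffices. *)
  rewrite gi0 in massg; rewrite mulrDr; move: hK; rewrite minEle; case: ifP => _ hK.
    by lra.
  have : 0 <= delta * L by rewrite mulr_ge0// ltW.
  by lra.
have part : \sum_(0 <= j < i) waste h j <= \sum_(0 <= j < i) waste g j + i%:R * e.
  rewrite -sum_e -big_split /=; apply: ler_sum_nat => j /andP[_ ji].
  by apply: le_trans (waste_lip g h j) _; rewrite lerD2l hg.
have : waste h i <= e.
  rewrite /waste; case: ifP => // _; apply: le_trans hi.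
  by rewrite /funrneg ge_max -normrN ler_norm normr_ge0.
by rewrite mulrDr; lra.
Qed.

End selection.

(** * Ranges of embeddings as subtrees, and the final estimate *)

Lemma subtree_range phi : embedding phi -> subtree (range phi).
Proof.
move=> Ephi; split.
  exists (phi [::]); apply/seteqP; split => [t [[s _ <-] tmin]|_ ->].
    by apply/esym/tmin; [exists [::]|exact: prefix_root].
  split; first by exists [::].
  by move=> _ [s _ <-]; rewrite Ephi prefixs0 => /eqP ->.
move=> _ [s _ <-]; exists (phi (s ++ [:: false])), (phi (s ++ [:: true])).
split.
  by rewrite (inj_eq (embedding_inj Ephi)) eqseq_cat// andbF.
have succ b : strict_prefix (phi s) (phi (s ++ [:: b])).
  by rewrite embedding_strict//; apply/strict_prefixP; exists b, [::].
apply/seteqP; split => t.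
  move=> [[[u _ <-]]]; rewrite embedding_strict// => /strict_prefixP[b [v ->]] umin.
  have <- : phi (s ++ [:: b]) = phi (s ++ b :: v).
    apply: umin; last by rewrite Ephi prefix_cat2l /= eqxx prefix0s.
    by split; [exists (s ++ [:: b])|exact: succ].
  by case: b {umin}; [right|left].
have succ_min b : imm_succ (range phi) (phi s) (phi (s ++ [:: b])).
  split; first by split; [exists (s ++ [:: b])|exact: succ].
  move=> _ [[u _ <-]]; rewrite embedding_strict// => /strict_prefixP[c [v ->]].
  by rewrite Ephi prefix_cat2l prefix_cons prefixs0 => /andP[/eqP -> /eqP ->].
by case=> ->; exact: succ_min.
Qed.

Theorem theorem2p1 (R : realType) (F : set (dyadic -> R)) (delta epsilon : R)
    (F_bcn : F `<=` @bcn R)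
    (F_compact : @compact {ptws dyadic -> R} F)
    (F_ball : F `<=` @unit_ball R)
    (delta_gt0 : 0 < delta) (epsilon_gt0 : 0 < epsilon)
    (epsilon_lt1 : epsilon < 1) :
  exists T : set dyadic, subtree T /\
    forall (C : set dyadic) (s : nat -> dyadic), chain T C -> chain_enum C s ->
    forall f : dyadic -> R, F f ->
    forall (n : nat) (I : {set 'I_n}), (forall i, i \in I -> 0 < f (s i)) ->
      delta < \sum_(i in I) f (s i) ->
    exists g : dyadic -> R, [/\ F g,
      \sum_(i in I) g^\+ (s i) > (1 - epsilon) * \sum_(i in I) f (s i) &
      \sum_(i < n | (i \notin I) || (g (s i) < 0)) `|g (s i)|
        < epsilon * \sum_(i in I) f (s i)].
Proof.
have F_le1 f : F f -> forall t, `|f t| <= 1.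
  move=> /F_ball h t; rewrite -lee_fin; apply: le_trans h.
  by apply: ereal_sup_ubound; exists t.
(* These sum to at most [epsilon / 4]: the mass drops by at most [delta * epsilon / 4], and the
   waste is at most [epsilon / 2] times the mass. *)
pose kappa (i : nat) : R := epsilon / 8 / 2 ^+ i.
pose e (i : nat) : R := delta * kappa i / i.+2%:R.
have kappa_gt0 i : 0 < kappa i by rewrite !divr_gt0// exprn_gt0.
have e_gt0 i : 0 < e i by rewrite divr_gt0// mulr_gt0.
have kappa_mono i j : (i <= j)%N -> kappa j <= kappa i.
  move=> ij; rewrite ler_pM2l ?divr_gt0// lef_pV2 ?posrE ?exprn_gt0//.
  by rewrite ler_eXn2l// ltr1n.
have e_mono i j : (i <= j)%N -> e j <= e i.
  move=> ij; apply: ler_pM.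
  - by rewrite mulr_ge0// ltW.
  - by rewrite invr_ge0.
  - by rewrite ler_pM2l// kappa_mono.
  - by rewrite lef_pV2 ?posrE// ler_nat.
have kappa_sum n : \sum_(0 <= k < n) kappa k <= epsilon / 4.
  suff -> : \sum_(0 <= k < n) kappa k = epsilon / 4 - 2 * kappa n.
    by rewrite lerBlDr lerDl mulr_ge0// ltW.
  elim: n => [|n IH]; first by rewrite big_geq// /kappa expr0; field.
  by rewrite big_nat_recr//= IH /kappa exprS; field; rewrite expf_neq0.
have Eid : embedding id by [].
(* The tolerance at a node depends on its depth, the number of its predecessors. *)
have [||phi [Ephi _] steer] := @fusion
    (fun a => steers F a (e (size a)) (kappa (size a))^-1) id Eid.
- by move=> a; exact: steers_hereditary.
- move=> a; apply: steers_dense => //.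
  by rewrite invr_ge0 ltW.
exists (range phi); split; first exact: subtree_range.
move=> C s [Cphi _ _] [sC s_lt] f Ff n I fI massI.
have s_phi i : range phi (s i) by apply: Cphi; rewrite -sC; exists i.
have {}s_phi i : exists u, phi u = s i by case: (s_phi i) => u; exists u.
have [u us] := choice s_phi.
have u_lt i j : (i < j)%N -> strict_prefix (u i) (u j).
  by move=> ij; rewrite -(embedding_strict _ _ Ephi) !us s_lt.
(* The chain may skip levels, but [s i] has depth at least [i], so the tolerance there is at most
   [e i] and the truncation bound at least [(kappa i)^-1]. *)
have size_u i : (i <= size (u i))%N.
  elim: i => [//|i IH]; apply: leq_ltn_trans IH _.
  have /strict_prefixP[b [v ->]] := u_lt i _ (ltnSn i).
  by rewrite size_cat /= addnS ltnS leq_addr.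
pose Ip : pred nat := [pred j | j \in [seq val i | i <- enum I]].
have IpE (i : 'I_n) : Ip i = (i \in I).
  by rewrite /Ip /= mem_map ?mem_enum//; exact: val_inj.
have massE (g : dyadic -> R) :
    \sum_(0 <= j < n | Ip j) (g \o s)^\+ j = \sum_(i in I) g^\+ (s i).
  by rewrite big_mkord; apply: eq_bigl.
have fE : \sum_(i in I) f (s i) = \sum_(0 <= j < n | Ip j) (f \o s)^\+ j.
  rewrite massE; apply: eq_bigr => i /fI fi.
  by apply/esym/max_idPl; exact: ltW.
rewrite fE in massI *.
have [|i i_n _ [g Fg <-]||_ [[g Fg <-] massg wasteg]] := @selection_step R
    [set f \o s | f in F] Ip n kappa delta kappa_gt0 delta_gt0 _ _
    (f \o s) _ massI n (leqnn n).
- by move=> _ [g Fg <-] i; exact: F_le1.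
- pose K := rev [seq s j | j <- [seq j <- index_iota i.+1 n | Ip j]].
  have KE h : pos_sum h K = \sum_(i.+1 <= j < n | Ip j) (h \o s)^\+ j.
    by rewrite /pos_sum big_rev big_map big_filter.
  have Kup : upper_chain (cone phi (u i)) K.
    split.
      rewrite rev_sorted sorted_map; apply: (sub_sorted (e := ltn)) => [j k|].
        exact: s_lt.
      apply: sorted_filter; first exact: ltn_trans.
      exact: iota_ltn_sorted.
    move=> t; rewrite mem_rev => /mapP[j].
    rewrite mem_filter mem_index_iota => /andP[_ /andP[ij _]] ->.
    rewrite cone_root us s_lt//; split => //.
    by apply: range_cone => //; [exists (u j)|rewrite us; case/andP: (s_lt _ _ ij)].
  have size_path : size (predecessors phi (u i)) = size (u i).
    by rewrite size_rev size_map size_iota.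
  have [h [Fh hg hi hK]] := steer (u i) K Kup g Fg.
  rewrite size_path cone_root us in hg hi hK.
  have ei := e_mono _ _ (size_u i).
  exists (h \o s); split; first by exists h.
  + move=> j ji; apply: le_trans (ei); apply: hg.
    by apply/predecessorsP; exists (u j); rewrite ?u_lt.
  + exact: le_trans ei.
  + rewrite -!KE; apply: le_trans hK; apply: lerB; last by rewrite ler_pM2l.
    rewrite le_min ge_min lexx /= ge_min.
    by rewrite lef_pV2 ?posrE// kappa_mono ?orbT.
- by exists f.
have sigma_gt0 := lt_trans delta_gt0 massI.
set sigma := \sum_(0 <= j < n | Ip j) (f \o s)^\+ j in massI massg wasteg sigma_gt0 *.
have L := kappa_sum n; set S := \sum_(0 <= k < n) kappa k in massg wasteg L.
have de : delta * epsilon < sigma * epsilon by rewrite ltr_pM2r.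
have dS : delta * S <= delta * (epsilon / 4) by rewrite ler_pM2l.
have sS : sigma * S <= sigma * (epsilon / 4) by rewrite ler_pM2l.
have se : 0 < sigma * epsilon by rewrite mulr_gt0.
exists g; split => //.
  by rewrite -massE; lra.
apply: le_lt_trans (_ : 2 * sigma * S < _); last by lra.
(* Each term of the error sum is bounded by the waste at its index: on [I] it is present only where
   [g] is negative. *)
apply: le_trans wasteg; rewrite big_mkord big_mkcond /=.
apply: ler_sum => i _; rewrite IpE /=; case: ifPn => [|].
  case: (i \in I) => //= gi; rewrite /funrneg/=.
  by rewrite ltr0_norm// le_max lexx.
by case: (i \in I).
Qed.
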